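(* Let $A\in\mathsf{L}_1\oplus\mathsf{L}_3\oplus\mathsf{L}_4$ be an orthogonal matrix. Then either $A\in\mathcal{OP}_4$, or there exist $4\times4$ permutation matrices $P,Q$ such that $PAQ$ or $H(PAQ)H$ is of the form $\begin{bmatrix}\pm1&\mathbf{0}^T\\ \mathbf{0}&X\end{bmatrix}$ for some orthogonal permutative matrix $X$ of order $3$, where $$H=\frac12\begin{bmatrix}1&1&1&1\\1&-1&1&-1\\1&1&-1&-1\\1&-1&-1&1\end{bmatrix}.$$
   Context: For a permutation $\sigma$ of $\{1,2,3,4\}$, $P_\sigma$ is the permutation matrix with $(i,j)$ entry $1$ if $\sigma(i)=j$ and $0$ otherwise. A matrix is permutative if each of its rows is a permutation of any other row; an orthogonal permutative matrix is a permutative matrix $A$ with $A^TA=I$, and $\mathcal{OP}_4$ is the set of orthogonal permutative matrices of order $4$. $\mathsf{L}_k$ is the real span of $\mathcal{B}_k$, where $\mathcal{B}_1=\{P_{(12)},P_{(34)},P_{(13)(24)},P_{(14)(23)}\}$, $\mathcal{B}_3=\{P_{(124)},P_{(234)}\}$, $\mathcal{B}_4=\{P_{(123)}\}$. The union of these $\mathcal{B}_k$ is linearly independent, so the sum is direct. Cycles such as $(124)$ mean $1\mapsto2\mapsto4\mapsto1$. *)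

(* Defs.v *)
From mathcomp Require Import all_boot all_order all_fingroup all_algebra.
From mathcomp Require Import reals.
Set Implicit Arguments.
Unset Strict Implicit.
Unset Printing Implicit Defensive.
Import GRing.Theory.
Local Open Scope ring_scope.

(* The symbols 1, 2, 3, 4 being permuted, shifted to 0, ..., 3. *)
Definition pt1 : 'I_4 := @Ordinal 4 0 isT.
Definition pt2 : 'I_4 := @Ordinal 4 1 isT.
Definition pt3 : 'I_4 := @Ordinal 4 2 isT.
Definition pt4 : 'I_4 := @Ordinal 4 3 isT.

(* The cycle a |-> b |-> c |-> a: products of permutations act from left to
   right, (s * t) x = t (s x). *)
Definition cycle3 (a b c : 'I_4) : 'S_4 := (tperm a b * tperm a c)%g.

Lemma cycle3E (a b c : 'I_4) : a != b -> b != c -> a != c ->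
  [/\ cycle3 a b c a = b, cycle3 a b c b = c & cycle3 a b c c = a].
Proof.
move=> ab bc ac; rewrite /cycle3 !permM tpermL tpermR tpermL.
by rewrite [tperm a b c]tpermD // tpermR tpermD // eq_sym.
Qed.

(* perm_mx s has (i, j) entry (s i == j). *)
Definition B1 (R : realType) : seq 'M[R]_4 :=
  [:: perm_mx (tperm pt1 pt2);
      perm_mx (tperm pt3 pt4);
      perm_mx (tperm pt1 pt3 * tperm pt2 pt4)%g;
      perm_mx (tperm pt1 pt4 * tperm pt2 pt3)%g].

Definition B3 (R : realType) : seq 'M[R]_4 :=
  [:: perm_mx (cycle3 pt1 pt2 pt4); perm_mx (cycle3 pt2 pt3 pt4)].

Definition B4 (R : realType) : seq 'M[R]_4 :=
  [:: perm_mx (cycle3 pt1 pt2 pt3)].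

Definition L1 (R : realType) : {vspace 'M[R]_4} := <<B1 R>>%VS.
Definition L3 (R : realType) : {vspace 'M[R]_4} := <<B3 R>>%VS.
Definition L4 (R : realType) : {vspace 'M[R]_4} := <<B4 R>>%VS.

Lemma free_B134 (R : realType) : free (B1 R ++ B3 R ++ B4 R).
Proof.
apply/(@freeP _ _ _ (in_tuple (B1 R ++ B3 R ++ B4 R))) => k.
rewrite !big_ord_recl big_ord0 addr0 /= /cycle3 => /matrixP k_eq0.
have pE (s : 'S_4) i j : perm_mx s i j = (s i == j)%:R :> R by rewrite !mxE.
have addE (M N : 'M[R]_4) i j : (M + N) i j = M i j + N i j by rewrite mxE.
have scE c (M : 'M[R]_4) i j : (c *: M) i j = c * M i j by rewrite mxE.
have zE i j : (0 : 'M[R]_4) i j = 0 by rewrite mxE.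
have simp := (permM, permE, pE, addE, scE, zE, mulr1, mulr0, addr0, add0r).
have := k_eq0 pt1 pt3; rewrite !simp /= ?simp => k2.
have := k_eq0 pt1 pt4; rewrite !simp /= ?simp => k3.
have := k_eq0 pt2 pt1; rewrite !simp /= ?simp => k0.
have := k_eq0 pt2 pt2; rewrite !simp /= ?simp => k1.
have := k_eq0 pt1 pt1; rewrite !simp /= ?simp k1 add0r => k5.
have := k_eq0 pt2 pt4; rewrite !simp /= ?simp k2 add0r => k4.
have := k_eq0 pt1 pt2; rewrite !simp /= ?simp k0 k4 !add0r => k6.
case=> [[|[|[|[|[|[|[|//]]]]]]] lti].
- by rewrite -[RHS]k0; congr k; apply: val_inj.
- by rewrite -[RHS]k1; congr k; apply: val_inj.
- by rewrite -[RHS]k2; congr k; apply: val_inj.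
- by rewrite -[RHS]k3; congr k; apply: val_inj.
- by rewrite -[RHS]k4; congr k; apply: val_inj.
- by rewrite -[RHS]k5; congr k; apply: val_inj.
- by rewrite -[RHS]k6; congr k; apply: val_inj.
Qed.

Lemma directv_L134 (R : realType) : directv (L1 R + L3 R + L4 R).
Proof.
have := free_B134 R.
rewrite catA !cat_free => /and3P[/and3P[_ _ d13] _ d134].
rewrite directv_addE /= directv_addE /= !directv_trivial /=.
by apply/andP; split; [apply/eqP/directv_addP|
  rewrite /L1 /L3 -span_cat; apply/eqP/directv_addP].
Qed.

Definition orthogonal_mx (R : realType) (n : nat) (A : 'M[R]_n) : Prop :=
  A^T *m A = 1%:M.

Definition permutative (R : realType) (n : nat) (A : 'M[R]_n) : Prop :=
  forall i j : 'I_n, exists s : 'S_n, row i A = col_perm s (row j A).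

Definition orthogonal_permutative (R : realType) (n : nat) (A : 'M[R]_n) :
  Prop := permutative A /\ orthogonal_mx A.

Definition H4 (R : realType) : 'M[R]_4 :=
  2^-1 *: \matrix_(i < 4, j < 4)
    (nth [::] [:: [:: 1;  1;  1;  1];
                  [:: 1; -1;  1; -1];
                  [:: 1;  1; -1; -1];
                  [:: 1; -1; -1;  1]] i)`_j.

Definition pm1_block_form (R : realType) (M : 'M[R]_4) : Prop :=
  exists (e : R) (X : 'M[R]_3),
    [/\ e = 1 \/ e = -1,
        orthogonal_permutative X
      & M = block_mx e%:M 0 0 X :> 'M[R]_(1 + 3)].

(* Main.v *)
(* Conjugation by H turns A into diag(S, B), where S is the common row sum and
   B = [[p, g, r + u], [u, q, -g], [r - g, v, -p]], the six parameters being
   independent linear forms in the coordinates of A.  Comparing the norms of the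
   rows of B with those of its columns gives v = u or v = -u, and r = 0 or
   u = -g.  Apart from the degenerate solutions, which all make A permutative,
   orthogonality then leaves r = 0, q = p, v = u: moving the second row and the
   third column of A to the front exhibits A as a multiple of the all-one matrix
   plus a combination of the permutation matrices diag(1, cyclic), and H
   conjugates each diag(1, cyclic) to a matrix of the same kind. *)
Require Import Defs.
From mathcomp Require Import all_boot all_order all_fingroup all_algebra.
From mathcomp Require Import reals ring lra zify.
Set Implicit Arguments.
Unset Strict Implicit.
Unset Printing Implicit Defensive.
Import GRing.Theory.
Local Open Scope ring_scope.

Definition seqs_mx (R : realType) n (s : seq (seq R)) : 'M[R]_n :=
  \matrix_(i < n, j < n) (nth [::] s i)`_j.

Lemma permutative_perm_eq (R : realType) n (A : 'M[R]_n) :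
  (forall i j, perm_eq [tuple A i k | k < n] [tuple A j k | k < n]) ->
  permutative A.
Proof.
move=> pA i j; have /tuple_permP[s sE] := pA i j; exists s.
apply/rowP => k; rewrite !mxE.
have /(congr1 (fun t => tnth t k)) := val_inj sE.
by rewrite !tnth_mktuple.
Qed.

(** Comparing each row with one reference list [t] as multisets spares exhibiting a permutation for
    every pair of rows. *)
Lemma permutative_seqs_mx (R : realType) n (s : seq (seq R)) (t : seq R) :
  size t = n -> size s = n -> all (perm_eq t) s -> permutative (seqs_mx n s).
Proof.
move=> st ss /(all_nthP [::]) sP.
have rowE i : perm_eq t [tuple seqs_mx n s i k | k < n].
  have lti : (i < size s)%N by rewrite ss.
  rewrite (permPl (sP _ lti)); set w := nth _ _ _.
  have sw : size w = n by rewrite -(perm_size (sP _ lti)).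
  rewrite [w in perm_eq w](_ : _ = [tuple seqs_mx n s i k | k < n] :> seq R) //.
  apply: (@eq_from_nth _ 0) => [|k]; rewrite ?size_tuple // sw => ltk.
  by rewrite -[k]/(val (Ordinal ltk)) -tnth_nth tnth_mktuple mxE.
by apply: permutative_perm_eq => i j; rewrite -(permPl (rowE i)) rowE.
Qed.

(** The witnesses are the coefficients of P_(12), P_(34), P_(13)(24), P_(14)(23), P_(124), P_(234),
    P_(123), in this order. *)
Lemma L134_seqs_mx (R : realType) (A : 'M[R]_4) :
  A \in (L1 R + L3 R + L4 R)%VS ->
  exists a b c d e f g : R, A = seqs_mx 4
    [:: [:: b + f; a + e + g; c; d];
        [:: a; b; d + f + g; c + e];
        [:: c + g; d; a + e; b + f];
        [:: d + e; c + f; b; a + g]].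
Proof.
rewrite /L1 /L3 /L4 !span_cons !span_nil !addv0.
case/memv_addP=> _ /memv_addP[_ /memv_addP[_ /vlineP[a ->]
  [_ /memv_addP[_ /vlineP[b ->] [_ /memv_addP[_ /vlineP[c ->]
  [_ /vlineP[d ->] ->]] ->]] ->]]
  [_ /memv_addP[_ /vlineP[e ->] [_ /vlineP[f ->] ->]] ->]]
  [_ /vlineP[g ->] ->].
exists a, b, c, d, e, f, g; apply/matrixP.
do 2![case=> [[|[|[|[|//]]]] ?]];
  rewrite !mxE /cycle3 !permM !permE /= ?permE /=; ring.
Qed.

(* The hypotheses say that rows 1, 2, columns 1, 2 of the block B of the header
   are unit vectors and that the rows of B are pairwise orthogonal. *)
Lemma orthogonal_6parameters (R : realType) (p q r g u v : R) :
    p ^+ 2 + g ^+ 2 + (r + u) ^+ 2 = 1 -> u ^+ 2 + q ^+ 2 + g ^+ 2 = 1 ->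
    p ^+ 2 + u ^+ 2 + (r - g) ^+ 2 = 1 -> g ^+ 2 + q ^+ 2 + v ^+ 2 = 1 ->
    p * u + g * q - g * (r + u) = 0 ->
    p * (r - g) + g * v - p * (r + u) = 0 ->
    u * (r - g) + q * v + g * p = 0 ->
  [\/ [/\ g = 0, u = 0 & v = 0],
      [/\ r = 0, q = p & v = u],
      [/\ p = 0, q = 0, r = 0, g = 0 & v = - u]
    | [/\ p = 0, q = 0, r = 0, u = 0 & v = 0]].
Proof.
move=> n1 n2 n3 n4 o1 o2 o3.
have [g0u0|[r0 pq]] : g = 0 /\ u = 0 \/ r = 0 /\ (q = p \/ q = - p).
  have /eqP : r * (u + g) = 0 by lra.
  have /eqP : (v - u) * (v + u) = 0 by lra.
  rewrite !mulf_eq0 subr_eq0 addr_eq0 => vu /orP[/eqP r0|].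
    right; split=> //; have /eqP : (q - p) * (q + p) = 0 by subst r; lra.
    by rewrite mulf_eq0 subr_eq0 addr_eq0 => /orP[]/eqP; [left|right].
  rewrite addr_eq0 => /eqP ug; left.
  (* With [u = - g], the relation between rows 1 and 3 shrinks to [g * v = 0], where [v] is [g] or
     [- g]. *)
  have /eqP : g * g = 0 by case/orP: vu => /eqP vu; subst u v; lra.
  by rewrite mulf_eq0 orbb => /eqP g0; rewrite ug g0 oppr0.
- have [g0 u0] := g0u0; subst g u; constructor 1; split=> //.
  have /eqP : v * v = 0 by lra.
  by rewrite mulf_eq0 orbb => /eqP.
subst r; have /eqP : (v - u) * (v + u) = 0 by lra.
rewrite mulf_eq0 subr_eq0 addr_eq0 => vu.
have [/andP[/eqP vu' /eqP qp]|mono] := boolP ((v == u) && (q == p)).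
  by constructor 2.
(* If [v = u] and [q = p], the three orthogonality relations coincide up to sign. Any other choice
   of signs makes them linearly independent in [g * u], [p * g], [p * u], which therefore vanish. *)
have [gu pg pu] : [/\ g * u = 0, p * g = 0 & p * u = 0].
  case/orP: vu => /eqP vu; case: pq => qp; subst v q;
    by [rewrite !eqxx in mono | split; lra].
have [p0|p_neq0] := eqVneq p 0; last first.
  move/eqP: pg; move/eqP: pu; rewrite !mulf_eq0 (negPf p_neq0) /=.
  move=> /eqP u0 /eqP g0; subst u g; constructor 1; split=> //.
  by case/orP: vu => /eqP ->; rewrite ?oppr0.
have q0 : q = 0 by case: pq => ->; rewrite p0 ?oppr0.
move: mono; rewrite q0 p0 eqxx andbT => v_neq_u.
move: vu; rewrite (negPf v_neq_u) /= => /eqP vu.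
move/eqP: gu; rewrite mulf_eq0 => /orP[]/eqP gu; first by constructor 3.
by constructor 4; split; rewrite // vu gu oppr0.
Qed.

Lemma orthogonal_mxM (R : realType) n (A B : 'M[R]_n) :
  orthogonal_mx A -> orthogonal_mx B -> orthogonal_mx (A *m B).
Proof.
by move=> oA oB; rewrite /orthogonal_mx trmx_mul mulmxA -(mulmxA B^T) oA mulmx1.
Qed.

Lemma orthogonal_perm_mx (R : realType) n (s : 'S_n) :
  orthogonal_mx (perm_mx s : 'M[R]_n).
Proof. by rewrite /orthogonal_mx tr_perm_mx -perm_mxM mulVg perm_mx1. Qed.

Lemma orthogonal_H4 (R : realType) : orthogonal_mx (H4 R).
Proof.
apply/matrixP.
do 2![case=> [[|[|[|[|//]]]] ?]]; rewrite !mxE !big_ord_recl big_ord0 !mxE /=;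
  by field.
Qed.

Lemma orthogonal_block_mx (R : realType) n (e : R) (X : 'M[R]_n) :
  orthogonal_mx (block_mx e%:M 0 0 X : 'M[R]_(1 + n)) ->
  (e = 1 \/ e = -1) /\ orthogonal_mx X.
Proof.
rewrite /orthogonal_mx tr_block_mx mulmx_block !trmx0 !mulmx0 !mul0mx.
rewrite !addr0 !add0r scalar_mx_block tr_scalar_mx -scalar_mxM.
move=> /eq_block_mx[/matrixP/(_ 0 0) ee1 _ _ oX]; split=> //.
move: ee1; rewrite !mxE eqxx !mulr1n => /eqP; rewrite -expr2 sqrf_eq1.
by case/orP=> /eqP; [left|right].
Qed.

(** The zeros come from the constant row and column sums: the first column of the symmetric matrix
    [H4 R] is constant and the others are orthogonal to it. *)
Lemma H4_conj (R : realType) (a b c d e f g : R) :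
  let p := c - d in let q := a + b - c - d in let r := b - a in
  let u := f - e in let v := e + f in
  H4 R *m seqs_mx 4
    [:: [:: b + f; a + e + g; c; d];
        [:: a; b; d + f + g; c + e];
        [:: c + g; d; a + e; b + f];
        [:: d + e; c + f; b; a + g]] *m H4 R
  = seqs_mx 4
    [:: [:: a + b + c + d + e + f + g; 0; 0; 0];
        [:: 0; p; g; r + u];
        [:: 0; u; q; - g];
        [:: 0; r - g; v; - p]].
Proof.
apply/matrixP; do 2![case=> [[|[|[|[|//]]]] ?]];
rewrite !mxE !big_ord_recl big_ord0 !mxE !big_ord_recl !big_ord0 !mxE /=;
  by field.
Qed.

(** With J all-one and C a cyclic shift, the inner matrix is a J + x I + y diag(1, C) + z diag(1,
    C^T). Conjugation sends J to 4 E_11 and transposes diag(1, C). *)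
Lemma H4_conj_circulant (R : realType) (a x y z : R) :
  H4 R *m seqs_mx 4
    [:: [:: a + x + y + z; a; a; a];
        [:: a; a + x; a + y; a + z];
        [:: a; a + z; a + x; a + y];
        [:: a; a + y; a + z; a + x]] *m H4 R
  = block_mx (4 * a + x + y + z)%:M 0 0
      (seqs_mx 3 [:: [:: x; z; y]; [:: y; x; z]; [:: z; y; x]])
  :> 'M[R]_(1 + 3).
Proof.
apply/(@matrixP R 4 4) => i j; rewrite [RHS]mxE.
case: i j => [[|[|[|[|//]]]] ?] [[|[|[|[|//]]]] ?];
case: splitP => [[[|//] ?]|[[|[|[|//]]] ?]] //= _; rewrite [RHS]mxE;
case: splitP => [[[|//] ?]|[[|[|[|//]]] ?]] //= _;
rewrite !mxE !big_ord_recl big_ord0 !mxE !big_ord_recl !big_ord0 !mxE /=;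
  by field.
Qed.

Theorem theorem3p11 (R : realType) (A : 'M[R]_4)
    (hA : A \in (L1 R + L3 R + L4 R)%VS) (hO : orthogonal_mx A) :
  orthogonal_permutative A \/
  exists P Q : 'M[R]_4,
    [/\ is_perm_mx P, is_perm_mx Q
      & pm1_block_form (P *m A *m Q) \/
        pm1_block_form (H4 R *m (P *m A *m Q) *m H4 R)].
Proof.
have [a [b [c [d [e [f [g AE]]]]]]] := L134_seqs_mx hA.
have oH := @orthogonal_H4 R.
have := orthogonal_mxM (orthogonal_mxM oH hO) oH.
rewrite {1}AE H4_conj; set B := seqs_mx _ _ => oB.
have colB i j : \sum_k B k i * B k j = (i == j)%:R.
  move/matrixP/(_ i j): oB; rewrite !mxE => <-.
  by apply: eq_bigr => k _; rewrite [B^T _ _]mxE.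
(* A left inverse of a square matrix is also a right inverse, so the rows are orthonormal too. *)
have rowB i j : \sum_k B i k * B j k = (i == j)%:R.
  move/mulmx1C/matrixP/(_ i j): oB; rewrite !mxE => <-.
  by apply: eq_bigr => k _; rewrite [B^T _ _]mxE.
have sumE (F : 'I_4 -> R) : \sum_k F k = F pt1 + F pt2 + F pt3 + F pt4.
  rewrite !big_ord_recl big_ord0 addr0 !addrA.
  by congr (F _ + F _ + F _ + F _); apply: val_inj.
have [] := @orthogonal_6parameters R (c - d) (a + b - c - d) (b - a) g
  (f - e) (e + f).
(* Index [pt1] carries the row sum; indices 1, 2, 3 of the 3 x 3 block are [pt2], [pt3], [pt4]. *)
- by have := rowB pt2 pt2; rewrite sumE !mxE /=; lra.
- by have := rowB pt3 pt3; rewrite sumE !mxE /=; lra.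
- by have := colB pt2 pt2; rewrite sumE !mxE /=; lra.
- by have := colB pt3 pt3; rewrite sumE !mxE /=; lra.
- by have := rowB pt2 pt3; rewrite sumE !mxE /=; lra.
- by have := rowB pt2 pt4; rewrite sumE !mxE /=; lra.
- by have := rowB pt3 pt4; rewrite sumE !mxE /=; lra.
- case=> g0 fe ef; left; split=> //; rewrite AE.
  have [e0 f0] : e = 0 /\ f = 0 by split; lra.
  subst e f g; rewrite !addr0.
  apply: (@permutative_seqs_mx _ _ _ [:: a; b; c; d]) => //=.
  (* Equality of multisets is equality of the counts of every predicate [P], a linear identity. *)
  by rewrite andbT; apply/and4P; split; apply/seq.permP => P /=; lia.
- case=> ab ac e0; right.
  have [ba ca e0'] : [/\ b = a, c = a & e = 0] by split; lra.
  (* Apart from their common entry [d + f + g], row 2 and column 3 of [A] are constantly [a]; the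
     transpositions bring that entry to the corner. *)
  exists (perm_mx (tperm pt1 pt2)), (perm_mx (tperm pt1 pt3)).
  rewrite !perm_mx_is_perm; split=> //; right.
  have oPAQ := orthogonal_mxM
    (orthogonal_mxM (orthogonal_perm_mx R (tperm pt1 pt2)) hO)
    (orthogonal_perm_mx R (tperm pt1 pt3)).
  have := orthogonal_mxM (orthogonal_mxM oH oPAQ) oH.
  (* [col_permE] involves the inverse permutation, which for a transposition is itself. *)
  rewrite -row_permE -[tperm pt1 pt3]invgK -col_permE tpermV.
  set M := col_perm _ _.
  have -> : M = seqs_mx 4 [:: [:: a + g + f + (d - a); a; a; a];
                              [:: a; a + g; a + f; a + (d - a)];
                              [:: a; a + (d - a); a + g; a + f];
                              [:: a; a + f; a + (d - a); a + g]].
    rewrite /M AE ba ca e0'; apply/matrixP.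
    do 2![case=> [[|[|[|[|//]]]] ?]]; rewrite !mxE !permE /=; ring.
  rewrite H4_conj_circulant => /orthogonal_block_mx[e1 oX].
  eexists _, _; split; [exact: e1|split; last exact: oX|by []].
  set z := d - a.
  apply: (@permutative_seqs_mx _ _ _ [:: f; g; z]) => //=.
  by rewrite andbT; apply/and3P; split; apply/seq.permP => P /=; lia.
- case=> cd abcd ab g0 f0; left; split=> //; rewrite AE.
  (* Here [A] is [a] times the all-one matrix plus [e] times P_(124). *)
  have [-> -> -> ->] : [/\ b = a, c = a, d = a & f = 0] by split; lra.
  rewrite g0 ?addr0 ?add0r.
  apply: (@permutative_seqs_mx _ _ _ [:: a + e; a; a; a]) => //=.
  by rewrite andbT; apply/and4P; split; apply/seq.permP => P /=; lia.
- case=> cd abcd ab fe ef; left; split=> //; rewrite AE.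
  (* Here [A] is [a] times the all-one matrix plus [g] times P_(123). *)
  have [-> -> -> ->] : [/\ b = a, c = a, d = a & f = 0] by split; lra.
  have -> : e = 0 by lra.
  rewrite ?addr0 ?add0r.
  apply: (@permutative_seqs_mx _ _ _ [:: a + g; a; a; a]) => //=.
  by rewrite andbT; apply/and4P; split; apply/seq.permP => P /=; lia.
Qed.
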